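(* Let $\mathcal{G}$ be a finite groupoid with connected components $\mathcal{G}_j$, $1\le j\le t$, and let $\mathcal{H}$ be a subgroupoid of $\mathcal{G}$ with connected components $\mathcal{K}_i$ and, for $e_i\in(\mathcal{K}_i)_0$, let $\mathcal{K}_{e_i}$ be the isotropy group of $\mathcal{K}_i$, for $1\le i\le n$. Put $\mathcal{H}_j=\mathcal{G}_j\cap\mathcal{H}$. Then $$(\mathcal{G}:\mathcal{H})=\sum_{j=1}^{t}|(\mathcal{H}_j)_0|\left(\sum_{i=1}^{n}(\mathcal{G}_{e_i}:\mathcal{K}_{e_i})\right).$$
   Context: A groupoid is a nonempty set $\mathcal{G}$ with a partially defined associative operation in which every $g$ has an inverse $g^{-1}$, a right identity $d(g)=g^{-1}g$ (domain) and a left identity $r(g)=gg^{-1}$ (range); the product $gh$ exists if and only if $d(g)=r(h)$. $\mathcal{G}_0$ is the set of identities and $\mathcal{G}_e=\{g:d(g)=r(g)=e\}$ is the isotropy group at $e\in\mathcal{G}_0$. A subgroupoid is a nonempty subset that is a groupoid under the restricted operation. A groupoid is connected if for any identities $e,f$ there is $g$ with $d(g)=e$, $r(g)=f$; every groupoid is the disjoint union of its connected components. $(\mathcal{H}_j)_0$ is the set of identities contained in $\mathcal{H}_j$ (empty if $\mathcal{H}_j=\emptyset$). For $g\in\mathcal{G}$ the right coset is $\mathcal{H}g=\{hg:h\in\mathcal{H},\ d(h)=r(g)\}$ and the left coset is $g\mathcal{H}=\{gh:h\in\mathcal{H},\ r(h)=d(g)\}$. The coset of $g$ in $\mathcal{H}$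 is called empty if $\mathcal{H}g=\emptyset$ or $g\mathcal{H}=\emptyset$, i.e. if $r(g)\notin\mathcal{H}_0$ or $d(g)\notin\mathcal{H}_0$. The index $(\mathcal{G}:\mathcal{H})$ is the number of (non-empty) cosets of $\mathcal{H}$ in $\mathcal{G}$, i.e. the number of distinct sets $\mathcal{H}g$ with $r(g),d(g)\in\mathcal{H}_0$. For a subgroup of a group, $(\,\cdot:\cdot\,)$ is the usual index.
   Formalization: The inner sum, for each j, runs only over those components K_i of H contained in G_j, not over all i from 1 to n; the displayed formula is false otherwise (G = H = two isolated identities gives index 2 but right-hand side 4). *)

(* Defs.v *)
From HB Require Import structures.
From mathcomp Require Import all_boot all_fingroup.

Set Implicit Arguments.
Unset Strict Implicit.
Unset Printing Implicit Defensive.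

(* [gop g h = Some x] means that the product gh exists and equals x. In
   [gopA] the two sides are compared as partial expressions: one is defined
   iff the other is, and then they are equal. *)
HB.mixin Record Finite_isGroupoid G of Finite G := {
  gop : G -> G -> option G;
  ginv : G -> G;
  gdom : G -> G;
  gran : G -> G;
  groupoid_nonempty : 0 < #|{: G}|;
  gop_exists : forall g h, isSome (gop g h) = (gdom g == gran h);
  gopA : forall g h k,
    obind (fun x => gop g x) (gop h k) = obind (fun x => gop x k) (gop g h);
  gopVg : forall g, gop (ginv g) g = Some (gdom g);
  gopgV : forall g, gop g (ginv g) = Some (gran g);
  gopgd : forall g, gop g (gdom g) = Some g;
  goprg : forall g, gop (gran g) g = Some g
}.

#[short(type="finGroupoidType")]
HB.structure Definition FinGroupoid := {G of Finite_isGroupoid G & Finite G}.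

Section Groupoid.
Variable G : finGroupoidType.
Implicit Types (g h k : G) (H C : {set G}).

(* Total version of [gop]; junk value g when gh does not exist. *)
Definition gmul g h : G := odflt g (gop g h).

Definition identities : {set G} := (gdom @: G) :|: (gran @: G).

Definition identities_in H : {set G} := [set e in H | e \in identities].

Definition identity := {e : G | e \in identities}.

(* Inverses and identities in H are necessarily those of the ambient
   groupoid: if gx = g for some x in H, then x = d(g) by cancellation. *)
Definition subgroupoid H : bool :=
  [&& H != set0,
      [forall g in H, forall h in H, (gdom g == gran h) ==> (gmul g h \in H)]
    & [forall g in H, [&& ginv g \in H, gdom g \in H & gran g \in H]]].

Definition connected H : bool :=
  [forall e in identities_in H, forall f in identities_in H,
    exists g in H, (gdom g == e) && (gran g == f)].

(* The connected components are the maximal connected subgroupoids. *)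
Definition components H : {set {set G}} :=
  [set C | maxset
     (fun C : {set G} => [&& C \subset H, subgroupoid C & connected C]) C].

Definition right_coset H g : {set G} :=
  [set gmul h g | h in H & gdom h == gran g].

Definition groupoid_index H : nat :=
  #|[set right_coset H g |
      g in [set g | (gran g \in identities_in H)
                    && (gdom g \in identities_in H)]]|.

Lemma gdom_ginv g : gdom (ginv g) = gran g.
Proof. by apply/eqP; rewrite -gop_exists gopVg. Qed.

Lemma gran_ginv g : gran (ginv g) = gdom g.
Proof. by apply/esym/eqP; rewrite -gop_exists gopgV. Qed.

Lemma gran_gdom g : gran (gdom g) = gdom g.
Proof. by apply/esym/eqP; rewrite -gop_exists gopgd. Qed.

Lemma gdom_gran g : gdom (gran g) = gran g.
Proof. by apply/eqP; rewrite -gop_exists goprg. Qed.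

Lemma gopE g h : gdom g = gran h -> gop g h = Some (gmul g h).
Proof.
by move/eqP; rewrite -gop_exists /gmul; case: (gop g h).
Qed.

Lemma gdom_gmul g h : gdom g = gran h -> gdom (gmul g h) = gdom h.
Proof.
move=> gh; have := gopA g h (gdom h).
rewrite gopgd (gopE gh) /= (gopE gh) => ghd.
by rewrite -(gran_gdom h); apply/eqP; rewrite -gop_exists -ghd.
Qed.

Lemma gran_gmul g h : gdom g = gran h -> gran (gmul g h) = gran g.
Proof.
move=> gh; have := gopA (gran g) g h.
rewrite goprg (gopE gh) /= (gopE gh) => rgh.
by rewrite -(gdom_gran g); apply/esym/eqP; rewrite -gop_exists rgh.
Qed.

Lemma gmulA g h k : gdom g = gran h -> gdom h = gran k ->
  gmul g (gmul h k) = gmul (gmul g h) k.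
Proof.
move=> gh hk; have := gopA g h k; rewrite (gopE gh) (gopE hk) /=.
by rewrite !gopE ?gran_gmul ?gdom_gmul // => -[].
Qed.

Lemma gdom_identity (e : identity) : gdom (val e) = val e.
Proof.
case: e => x /= /setUP[] /imsetP[g _ ->]; last exact: gdom_gran.
by rewrite -(gran_ginv g) gdom_gran.
Qed.

Lemma gran_identity (e : identity) : gran (val e) = val e.
Proof. by rewrite -gdom_identity gran_gdom. Qed.

End Groupoid.

Section Isotropy.
Variables (G : finGroupoidType) (e : identity G).

Definition in_isotropy : pred G :=
  fun g => (gdom g == val e) && (gran g == val e).

Record isotropy := Isotropy {
  isotropy_val : G;
  _ : in_isotropy isotropy_val
}.

HB.instance Definition _ := [isSub for isotropy_val].
HB.instance Definition _ := [Finite of isotropy by <:].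

Lemma isotropy_dom (x : isotropy) : gdom (val x) = val e.
Proof. by case: x => g /= /andP[/eqP]. Qed.

Lemma isotropy_ran (x : isotropy) : gran (val x) = val e.
Proof. by case: x => g /= /andP[_ /eqP]. Qed.

Lemma isotropy_comp (x y : isotropy) : gdom (val x) = gran (val y).
Proof. by rewrite isotropy_dom isotropy_ran. Qed.

Fact isotropy_mul_subproof (x y : isotropy) : in_isotropy (gmul (val x) (val y)).
Proof.
by rewrite /in_isotropy gdom_gmul ?gran_gmul ?isotropy_dom ?isotropy_ran ?eqxx.
Qed.

Fact isotropy_one_subproof : in_isotropy (val e).
Proof. by rewrite /in_isotropy gdom_identity gran_identity eqxx. Qed.

Fact isotropy_inv_subproof (x : isotropy) : in_isotropy (ginv (val x)).
Proof.
by rewrite /in_isotropy gdom_ginv gran_ginv isotropy_dom isotropy_ran eqxx.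
Qed.

Definition isotropy_mul x y := Isotropy (isotropy_mul_subproof x y).
Definition isotropy_one := Isotropy isotropy_one_subproof.
Definition isotropy_inv x := Isotropy (isotropy_inv_subproof x).

Fact isotropy_mulA : associative isotropy_mul.
Proof. by move=> x y z; apply/val_inj/gmulA; apply: isotropy_comp. Qed.

Fact isotropy_mul1 : left_id isotropy_one isotropy_mul.
Proof.
by move=> x; apply: val_inj; rewrite /= -(isotropy_ran x) /gmul goprg.
Qed.

Fact isotropy_mulV : left_inverse isotropy_one isotropy_inv isotropy_mul.
Proof.
by move=> x; apply: val_inj; rewrite /= -(isotropy_dom x) /gmul gopVg.
Qed.

HB.instance Definition _ :=
  Finite_isGroup.Build isotropy isotropy_mulA isotropy_mul1 isotropy_mulV.

Definition isotropy_in (H : {set G}) : {set isotropy} :=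
  [set x | val x \in H].

(* If e belongs to a subgroupoid H, its isotropy group in H is a subgroup of
   the isotropy group of e in the whole groupoid. *)
Lemma isotropy_in_group (H : {set G}) :
  subgroupoid H -> val e \in H -> group_set (isotropy_in H).
Proof.
case/and3P=> _ /forall_inP Hmul _ He; apply/group_setP; split=> [|x y].
  by rewrite inE.
rewrite !inE => Hx Hy; have /forall_inP/(_ _ Hy)/implyP := Hmul _ Hx.
by apply; rewrite isotropy_dom isotropy_ran.
Qed.

End Isotropy.

(* Main.v *)
Require Import Defs.
From mathcomp Require Import all_boot all_fingroup.

(** All elements of a coset Hg have the domain of g, and Hg = Hg' exactly when
    d(g) = d(g') and g g'^-1 belongs to H.  Hence two elements with the same
    coset have ranges in the same component of H, and a non-empty coset
    determines two things: the identity f = d(g) of H and the index i of the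
    component K_i that contains r(g).

    Multiplying g on the left by an element of K_i does not change Hg, so the
    cosets attached to the pair (f, i) are those of the arrows g from f to the
    chosen identity e_i.  Such arrows exist only when f lies in the component
    G_j of the whole groupoid that contains K_i.  In that case, fixing one
    arrow g0 turns x |-> x g0 into a bijection from the isotropy group of G at
    e_i onto these arrows, and H x g0 = H y g0 exactly when x and y are in the
    same right coset of the isotropy group of K_i.  So each pair (f, i) with f
    and K_i in the same G_j contributes the group index at e_i
    ([card_cosets_between]), and there are |(H_j)_0| such f for every i.
    Summing over i first, where the j with K_i inside G_j is unique, and
    exchanging sums gives the formula.

    The facts about components all follow from one explicit description: the
    component of H at an identity x is the set of the elements of H whose
    range can be reached from x inside H ([componentE]). *)

Set Implicit Arguments.
Unset Strict Implicit.
Unset Printing Implicit Defensive.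

(** * Cardinals of images *)

(** The fibres of g on A refine those of f, so f factors through g; the [option]
    avoids asking for a default value in rT. *)
Lemma leq_card_imset_ker (aT rT sT : finType) (A : {set aT})
    (f : aT -> rT) (g : aT -> sT) :
  {in A &, forall x y, g x = g y -> f x = f y} -> #|f @: A| <= #|g @: A|.
Proof.
move=> ker_gf.
pose h b := if [pick x in A | g x == b] is Some x then Some (f x) else None.
suff -> : #|f @: A| = #|h @: (g @: A)| by apply: leq_imset_card.
rewrite -(card_imset (f @: A) (@Some_inj _)) -!imset_comp.
congr #|pred_of_set _|; apply: eq_in_imset => x Ax; rewrite /= /h.
case: pickP => [y /andP[Ay /eqP gyx]|/(_ x)]; last by rewrite /= Ax eqxx.
by congr Some; apply: ker_gf.
Qed.

Lemma eq_card_imset_ker (aT rT sT : finType) (A : {set aT})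
    (f : aT -> rT) (g : aT -> sT) :
  {in A &, forall x y, f x = f y <-> g x = g y} -> #|f @: A| = #|g @: A|.
Proof.
move=> ker_fg; apply/eqP; rewrite eqn_leq.
by rewrite !leq_card_imset_ker // => x y Ax Ay; case: (ker_fg x y Ax Ay).
Qed.

(** * Calculus in a groupoid *)

Section Calculus.
Variable G : finGroupoidType.
Implicit Types (g h k x : G) (H C : {set G}).

Lemma gmulgV g : gmul g (ginv g) = gran g.
Proof. by rewrite /gmul gopgV. Qed.

Lemma gmulVg g : gmul (ginv g) g = gdom g.
Proof. by rewrite /gmul gopVg. Qed.

Lemma gmulgd g : gmul g (gdom g) = g.
Proof. by rewrite /gmul gopgd. Qed.

Lemma gmulrg g : gmul (gran g) g = g.
Proof. by rewrite /gmul goprg. Qed.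

Lemma gmulK g h : gdom g = gran h -> gmul (gmul g h) (ginv h) = g.
Proof. by move=> gh; rewrite -gmulA ?gran_ginv // gmulgV -gh gmulgd. Qed.

Lemma gmulVK g h : gdom g = gdom h -> gmul (gmul g (ginv h)) h = g.
Proof.
by move=> gh; rewrite -gmulA ?gran_ginv ?gdom_ginv // gmulVg -gh gmulgd.
Qed.

Lemma gran_identities g : gran g \in identities G.
Proof. by apply/setUP; right; apply: imset_f. Qed.

Lemma gdom_id x : x \in identities G -> gdom x = x.
Proof. by move=> idx; apply: (gdom_identity (exist _ x idx)). Qed.

Lemma gran_id x : x \in identities G -> gran x = x.
Proof. by move=> idx; apply: (gran_identity (exist _ x idx)). Qed.

Lemma mem_identities_in H x :
  (x \in identities_in H) = (x \in H) && (x \in identities G).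
Proof. by rewrite inE. Qed.

Section Subgroupoid.
Variable H : {set G}.
Hypothesis subH : subgroupoid H.

Lemma subgroupoid_mul g h :
  g \in H -> h \in H -> gdom g = gran h -> gmul g h \in H.
Proof.
case/and3P: subH => _ /forall_inP Hmul _ Hg Hh /eqP.
by apply/implyP; apply: (forall_inP (Hmul g Hg)).
Qed.

Lemma subgroupoid_inv g : g \in H -> ginv g \in H.
Proof. by case/and3P: subH => _ _ /forall_inP HV /HV/and3P[]. Qed.

Lemma subgroupoid_dom g : g \in H -> gdom g \in H.
Proof. by case/and3P: subH => _ _ /forall_inP HV /HV/and3P[]. Qed.

Lemma subgroupoid_ran g : g \in H -> gran g \in H.
Proof. by case/and3P: subH => _ _ /forall_inP HV /HV/and3P[]. Qed.

Lemma ginv_mem g : (ginv g \in H) = (g \in H).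
Proof.
suff ginvK : ginv (ginv g) = g.
  by apply/idP/idP=> [/subgroupoid_inv|/subgroupoid_inv //]; rewrite ginvK.
have := gmulK (g := g) (h := ginv g); rewrite gran_ginv gmulgV => /(_ erefl).
by rewrite -gdom_ginv -gran_ginv gmulrg.
Qed.

End Subgroupoid.

Lemma subgroupoidT : subgroupoid [set: G].
Proof.
apply/and3P; split; first by rewrite -card_gt0 cardsT groupoid_nonempty.
  by apply/forall_inP=> g _; apply/forall_inP=> h _; rewrite inE implybT.
by apply/forall_inP=> g _; rewrite !inE.
Qed.

(** * Connected components *)

Definition reachable H x : {set G} :=
  [set g in H | [exists h in H, (gdom h == x) && (gran h == gran g)]].

Lemma reachableP H x g :
  reflect (g \in H /\ exists2 h, h \in H & gdom h = x /\ gran h = gran g)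
          (g \in reachable H x).
Proof.
rewrite inE; apply: (iffP andP) => -[Hg].
  by case/exists_inP=> h Hh /andP[/eqP dh /eqP rh]; split=> //; exists h.
case=> h Hh [dh rh]; split=> //; apply/exists_inP.
by exists h => //; rewrite dh rh !eqxx.
Qed.

Lemma reachableS H1 H2 x : H1 \subset H2 -> reachable H1 x \subset reachable H2 x.
Proof.
move=> /subsetP sH; apply/subsetP=> g /reachableP[/sH Hg [h /sH Hh xhg]].
by apply/reachableP; split=> //; exists h.
Qed.

Lemma reachable_refl H x : x \in identities_in H -> x \in reachable H x.
Proof.
rewrite mem_identities_in => /andP[Hx idx].
by apply/reachableP; split=> //; exists x => //; rewrite ?gdom_id.
Qed.

Lemma reachable_subgroupoid H x :
  subgroupoid H -> x \in identities_in H -> subgroupoid (reachable H x).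
Proof.
move=> subH Hx; apply/and3P; split.
- by apply/set0Pn; exists x; apply: reachable_refl.
- apply/forall_inP=> g /reachableP[Hg [p Hp [dp rp]]].
  apply/forall_inP=> h /reachableP[Hh _]; apply/implyP=> /eqP gh.
  apply/reachableP; split; first exact: subgroupoid_mul.
  by exists p => //; rewrite gran_gmul.
- apply/forall_inP=> g /reachableP[Hg [p Hp [dp rp]]].
  have Hq : gmul (ginv g) p \in H.
    by rewrite subgroupoid_mul ?subgroupoid_inv ?gdom_ginv.
  have [dq rq] : gdom (gmul (ginv g) p) = x /\ gran (gmul (ginv g) p) = gdom g.
    by rewrite gdom_gmul ?gran_gmul ?gdom_ginv ?gran_ginv.
  apply/and3P; split; apply/reachableP.
  + split; first exact: subgroupoid_inv.
    by exists (gmul (ginv g) p) => //; rewrite gran_ginv.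
  + split; first exact: subgroupoid_dom.
    by exists (gmul (ginv g) p) => //; rewrite gran_gdom.
  + split; first exact: subgroupoid_ran.
    by exists p => //; rewrite (gran_id (gran_identities g)).
Qed.

Lemma reachable_connected H x : subgroupoid H -> connected (reachable H x).
Proof.
move=> subH; apply/forall_inP=> y; rewrite mem_identities_in.
case/andP=> /reachableP[Hy [p Hp [dp rp]]] idy.
apply/forall_inP=> z; rewrite mem_identities_in.
case/andP=> /reachableP[Hz [q Hq [dq rq]]] idz.
have qp : gdom q = gran (ginv p) by rewrite gran_ginv dq.
apply/exists_inP; exists (gmul q (ginv p)).
  apply/reachableP; split; last by exists q => //; rewrite gran_gmul.
  by rewrite subgroupoid_mul ?subgroupoid_inv.
by rewrite gdom_gmul // gran_gmul // gdom_ginv rp rq !gran_id // !eqxx.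
Qed.

Lemma connected_sub_reachable H C x :
    C \subset H -> subgroupoid C -> connected C -> x \in identities_in C ->
  C \subset reachable H x.
Proof.
move=> sCH subC /forall_inP connC Cx; apply: subset_trans (reachableS x sCH).
apply/subsetP=> g Cg; apply/reachableP; split=> //.
have Cr : gran g \in identities_in C.
  by rewrite mem_identities_in gran_identities subgroupoid_ran.
have /exists_inP[h Ch /andP[/eqP dh /eqP rh]] := forall_inP (connC x Cx) _ Cr.
by exists h.
Qed.

Lemma componentP H C : C \in components H ->
  [/\ C \subset H, subgroupoid C & connected C].
Proof. by rewrite inE => /maxsetp /and3P. Qed.

(** The reachable set is connected and contains every connected subgroupoid
    through x, so a maximal one cannot differ from it. *)
Lemma componentE H C x : subgroupoid H -> C \in components H ->
  x \in identities_in C -> C = reachable H x.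
Proof.
move=> subH cC Cx; have [sCH subC connC] := componentP cC.
move: cC; rewrite inE => /maxsetP[_ maxC]; apply/esym/maxC; last first.
  exact: connected_sub_reachable sCH subC connC Cx.
have Hx : x \in identities_in H.
  by move: Cx; rewrite !mem_identities_in => /andP[/(subsetP sCH)-> ->].
rewrite reachable_subgroupoid ?reachable_connected // !andbT.
by apply/subsetP=> g /reachableP[].
Qed.

Lemma reachable_component H x :
  subgroupoid H -> x \in identities_in H -> reachable H x \in components H.
Proof.
move=> subH Hx.
have conn : [&& reachable H x \subset H, subgroupoid (reachable H x)
              & connected (reachable H x)].
  rewrite reachable_subgroupoid ?reachable_connected // !andbT.
  by apply/subsetP=> g /reachableP[].
have [C maxC sxC] := maxset_exists
  (P := fun C => [&& C \subset H, subgroupoid C & connected C]) conn.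
have cC : C \in components H by rewrite inE.
rewrite -(componentE (x := x) subH cC) //.
move: (Hx); rewrite !mem_identities_in => /andP[_ ->].
by rewrite (subsetP sxC) ?reachable_refl.
Qed.

Lemma component_mem_ran H C g : subgroupoid H -> C \in components H ->
  g \in H -> (gran g \in C) = (g \in C).
Proof.
move=> subH cC Hg; have [_ subC _] := componentP cC.
apply/idP/idP=> [Cr|]; last exact: subgroupoid_ran.
rewrite (componentE (x := gran g) subH cC)
  ?mem_identities_in ?Cr ?gran_identities //.
apply/reachableP; split=> //; exists (gran g); first exact: subgroupoid_ran.
by rewrite gdom_gran (gran_id (gran_identities g)).
Qed.

Lemma component_mem_dom H C g : subgroupoid H -> C \in components H ->
  g \in H -> (gdom g \in C) = (g \in C).
Proof.
move=> subH cC Hg; have [_ subC _] := componentP cC.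
rewrite -gran_ginv (component_mem_ran subH cC (subgroupoid_inv subH Hg)).
exact: ginv_mem.
Qed.

Lemma component_inj H C D g : subgroupoid H ->
  C \in components H -> D \in components H -> g \in C -> g \in D -> C = D.
Proof.
move=> subH cC cD Cg Dg.
have [[_ subC _] [_ subD _]] := (componentP cC, componentP cD).
by rewrite (componentE (x := gran g) subH cC) 1?(componentE (x := gran g) subH cD)
  ?mem_identities_in ?gran_identities ?subgroupoid_ran.
Qed.

(** * Equality of cosets *)

Lemma mem_right_coset H g h :
  (h \in right_coset H g) = (gdom h == gdom g) && (gmul h (ginv g) \in H).
Proof.
apply/imsetP/andP=> [[k /setIdP[Hk /eqP kg] ->]|[/eqP hg Hhg]].
  by rewrite gdom_gmul // gmulK.
exists (gmul h (ginv g)); last by rewrite gmulVK.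
by rewrite inE Hhg gdom_gmul ?gdom_ginv ?gran_ginv //=.
Qed.

Lemma right_coset_refl H g : gran g \in H -> g \in right_coset H g.
Proof. by move=> Hr; rewrite mem_right_coset eqxx gmulgV. Qed.

Lemma right_coset_mull H g k : subgroupoid H -> k \in H -> gdom k = gran g ->
  right_coset H (gmul k g) = right_coset H g.
Proof.
move=> subH Hk kg; apply/setP=> h; apply/imsetP/imsetP=> -[l].
  rewrite inE gran_gmul // => /andP[Hl /eqP lk] ->.
  exists (gmul l k); last by rewrite gmulA.
  by rewrite inE subgroupoid_mul // gdom_gmul // kg eqxx.
rewrite inE => /andP[Hl /eqP lg] ->.
have lk : gdom l = gran (ginv k) by rewrite gran_ginv lg.
exists (gmul l (ginv k)).
  rewrite inE subgroupoid_mul ?subgroupoid_inv // gdom_gmul //.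
  by rewrite gdom_ginv gran_gmul ?eqxx.
rewrite -gmulA ?gdom_ginv ?gran_gmul // [gmul (ginv k) _]gmulA ?gdom_ginv //.
by rewrite gmulVg kg gmulrg.
Qed.

Lemma right_coset_eqP H g h : subgroupoid H -> gran g \in H ->
  right_coset H g = right_coset H h <->
  gdom g = gdom h /\ gmul g (ginv h) \in H.
Proof.
move=> subH Hr; split=> [eq_gh|[gh Hgh]].
  have := right_coset_refl Hr.
  by rewrite eq_gh mem_right_coset => /andP[/eqP-> ->].
have ghV : gdom g = gran (ginv h) by rewrite gran_ginv.
by rewrite -(right_coset_mull (g := h) subH Hgh) ?gmulVK // gdom_gmul ?gdom_ginv.
Qed.

(** * Cosets with prescribed end points *)

Definition arrows x y : {set G} := [set g | (gdom g == x) && (gran g == y)].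

Definition cosets_between H x y : {set {set G}} := right_coset H @: arrows x y.

(** Any arrow g0 from x to e trivialises the torsor of arrows from x to e over
    the isotropy group at e, and it cancels in (u g0)(v g0)^-1 = u v^-1. *)
Lemma card_cosets_between H (e : identity G) x :
    subgroupoid H -> val e \in H -> arrows x (val e) != set0 ->
  #|cosets_between H x (val e)| = #|[set: isotropy e] : isotropy_in e H|%g.
Proof.
move=> subH He /set0Pn[g0]; rewrite inE => /andP[/eqP d0 /eqP r0].
have comp0 (u : isotropy e) : gdom (val u) = gran g0.
  by rewrite r0 isotropy_dom.
have -> : cosets_between H x (val e) =
    [set right_coset H (gmul (val u) g0) | u in [set: isotropy e]].
  rewrite /cosets_between [RHS](imset_comp _ (fun u => gmul (val u) g0)).
  congr [set right_coset H g | g in pred_of_set _].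
  apply/setP=> g; rewrite inE; apply/andP/imsetP=> [[/eqP dg /eqP rg]|[u _ ->]].
    have dg0 : gdom g = gdom g0 by rewrite d0.
    have iso : in_isotropy e (gmul g (ginv g0)).
      by rewrite /in_isotropy gdom_gmul ?gran_gmul ?gdom_ginv ?gran_ginv
        ?r0 ?rg ?eqxx.
    by exists (Isotropy iso); rewrite ?inE /= ?gmulVK.
  by rewrite gdom_gmul // gran_gmul // isotropy_ran d0 !eqxx.
rewrite /indexg /rcosets; apply: eq_card_imset_ker => u v _ _.
have uvE : gmul (gmul (val u) g0) (ginv (gmul (val v) g0)) = val (u * v^-1)%g.
  have u0v : gdom (gmul (val u) g0) = gdom (gmul (val v) g0).
    by rewrite !gdom_gmul.
  have uV : gdom (val u) = gran (ginv (val v)).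
    by rewrite gran_ginv !isotropy_dom.
  have uVv : gdom (gmul (val u) (ginv (val v))) = gran (gmul (val v) g0).
    by rewrite gdom_gmul // gdom_ginv gran_gmul.
  have E : gmul (gmul (val u) (ginv (val v))) (gmul (val v) g0) =
      gmul (val u) g0.
    have Vv : gdom (gmul (val u) (ginv (val v))) = gran (val v).
      by rewrite gdom_gmul // gdom_ginv.
    by rewrite gmulA // gmulVK // !isotropy_dom.
  by rewrite -E gmulK.
have Hr : gran (gmul (val u) g0) \in H by rewrite gran_gmul // isotropy_ran.
pose Ke := Group (isotropy_in_group subH He).
have cosetE : u \in (Ke :* v)%g = (val (u * v^-1)%g \in H).
  by rewrite mem_rcoset inE.
rewrite !rcosetE; split=> [/(right_coset_eqP _ subH Hr)[_]|].
  by rewrite uvE -cosetE => /rcoset_eqP.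
move/(rcoset_eqP (G := Ke)); rewrite cosetE -uvE => uv.
by apply/(right_coset_eqP _ subH Hr); rewrite !gdom_gmul.
Qed.

End Calculus.

(** * The index formula *)

Theorem theorem4p5 (G : finGroupoidType) (H : {set G}) (subH : subgroupoid H)
    (t : nat) (Gc : 'I_t -> {set G})
    (Gc_inj : injective Gc)
    (Gc_components : [set Gc j | j : 'I_t] = components [set: G])
    (n : nat) (K : 'I_n -> {set G})
    (K_inj : injective K)
    (K_components : [set K i | i : 'I_n] = components H)
    (e : 'I_n -> identity G)
    (eK : forall i : 'I_n, val (e i) \in identities_in (K i)) :
  groupoid_index H =
    \sum_(j < t) #|identities_in (Gc j :&: H)| *
      (\sum_(i < n | K i \subset Gc j)
         #|[set: isotropy (e i)] : isotropy_in (e i) (K i)|%g).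
Proof.
have subT := subgroupoidT G.
have KH i : K i \in components H by rewrite -K_components imset_f.
have GcT j : Gc j \in components [set: G] by rewrite -Gc_components imset_f.
have eKi i : val (e i) \in K i.
  by have := eK i; rewrite mem_identities_in => /andP[].
have ide i : val (e i) \in identities G by case: (e i).
have eH i : val (e i) \in H.
  by have [sKH _ _] := componentP (KH i); apply: (subsetP sKH).
have memK i g : g \in H -> gran g \in K i -> g \in K i.
  by move=> Hg; rewrite (component_mem_ran subH (KH i) Hg).
have memG j g : gdom g \in Gc j -> gran g \in Gc j.
  rewrite (component_mem_dom subT (GcT j)) ?inE //.
  by rewrite (component_mem_ran subT (GcT j)) ?inE.
have KGc i : exists2 j, K i \subset Gc j & forall j', K i \subset Gc j' -> j' = j.
  have Te : val (e i) \in identities_in [set: G].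
    by rewrite mem_identities_in inE ide.
  have := reachable_component subT Te; rewrite -Gc_components.
  case/imsetP=> j _ Gj; exists j => [|j' /subsetP sKG].
    rewrite -Gj (componentE subH (KH i) (eK i)).
    by apply: reachableS; apply: subsetT.
  apply/Gc_inj/(component_inj subT (GcT j') (GcT j) (sKG _ (eKi i))).
  by rewrite -Gj reachable_refl.
(* The pair (x, i) indexes the cosets of the arrows from x to e_i; set0 makes
   the union run over a finite type. *)
pose F (p : G * 'I_n) :=
  if p.1 \in identities_in H then cosets_between H p.1 (val (e p.2)) else set0.
have FE x i : F (x, i) =
    if x \in identities_in H then cosets_between H x (val (e i)) else set0 by [].
have -> : groupoid_index H = #|\bigcup_p F p|.
  rewrite /groupoid_index; congr #|pred_of_set _|; apply/setP=> A.
  apply/imsetP/bigcupP=> [[g]|[[x i] _]].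
    rewrite inE => /andP[Hr Hd] ->.
    have := reachable_component subH Hr; rewrite -K_components.
    case/imsetP=> i _ Ki.
    have rK : gran g \in identities_in (K i).
      by rewrite mem_identities_in -Ki reachable_refl // gran_identities.
    have [sKH _ /forall_inP connK] := componentP (KH i).
    (* An arrow k of K_i from r(g) to e_i moves g inside its coset. *)
    have /exists_inP[k Kk /andP[/eqP dk /eqP rk]] :=
      forall_inP (connK _ rK) _ (eK i).
    exists (gdom g, i) => //; rewrite FE Hd; apply/imsetP.
    exists (gmul k g); last by rewrite right_coset_mull // (subsetP sKH).
    by rewrite inE gdom_gmul // gran_gmul // rk !eqxx.
  rewrite FE; case: ifP => [Hx|_]; last by rewrite inE.
  case/imsetP=> g; rewrite inE => /andP[/eqP dg /eqP rg] ->.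
  by exists g => //; rewrite inE dg rg Hx mem_identities_in eH ide.
have disjF p q : p != q -> [disjoint F p & F q].
  case: p q => [x i] [y i'] neq; rewrite -setI_eq0; apply/set0Pn => -[A].
  rewrite inE !FE; case: ifP => [_|_]; last by rewrite inE.
  case: ifP => [_|_]; last by rewrite inE andbF.
  case/andP=> /imsetP[g]; rewrite inE => /andP[/eqP dg /eqP rg] ->.
  case/imsetP=> h; rewrite inE => /andP[/eqP dh /eqP rh].
  have Hr : gran g \in H by rewrite rg.
  case/(right_coset_eqP _ subH Hr)=> gh Hgh.
  have ghV : gdom g = gran (ginv h) by rewrite gran_ginv.
  case/negP: neq; apply/eqP; congr (_, _); first by rewrite -dg -dh.
  apply/K_inj/(component_inj subH (KH i) (KH i') _ (eKi i')).
  rewrite -rh -gdom_ginv -(gdom_gmul ghV) (component_mem_dom subH (KH i) Hgh).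
  by apply: memK => //; rewrite gran_gmul ?rg.
rewrite -sum1_card partition_disjoint_bigcup //=.
under eq_bigr do rewrite sum1_card.
rewrite -(pair_bigA _ (fun x i => #|F (x, i)|)) exchange_big /=.
under [RHS]eq_bigr do rewrite big_distrr /=.
rewrite [RHS](exchange_big_dep predT) //=.
apply: eq_bigr => i _; have [j sKj uniqj] := KGc i.
rewrite (big_pred1 j) => [|j']; last first.
  by rewrite /=; apply/idP/eqP=> [/uniqj|->].
have ej : val (e i) \in Gc j by apply: (subsetP sKj).
have -> : isotropy_in (e i) (K i) = isotropy_in (e i) H.
  apply/setP=> u; rewrite !inE; have [sKH _ _] := componentP (KH i).
  apply/idP/idP=> [/(subsetP sKH)//|Hu].
  by apply: memK => //; rewrite isotropy_ran.
rewrite -sum_nat_const [RHS]big_mkcond; apply: eq_bigr => x _ /=.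
rewrite FE !mem_identities_in in_setI -andbA.
case: (boolP ((x \in H) && _)) => [/andP[Hx idx]|_]; last first.
  by rewrite cards0 andbF.
rewrite andbT; case: ifP => [xj|/negP xj].
  apply: card_cosets_between => //.
  have [_ _ /forall_inP connG] := componentP (GcT j).
  have Gx : x \in identities_in (Gc j) by rewrite mem_identities_in xj.
  have Ge : val (e i) \in identities_in (Gc j) by rewrite mem_identities_in ej ide.
  have /exists_inP[g _ xg] := forall_inP (connG x Gx) _ Ge.
  by apply/set0Pn; exists g; rewrite inE.
(* Without an arrow from x to e_i there is no coset for the pair (x, i). *)
apply/eqP; rewrite cards_eq0 -subset0; apply/subsetP=> A.
case/imsetP=> g; rewrite inE => /andP[/eqP dg /eqP rg] _.
case: xj; rewrite -dg (component_mem_dom subT (GcT j)) ?inE //.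
by rewrite -(component_mem_ran subT (GcT j)) ?inE // rg.
Qed.
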